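(* Let $(X_n)_{n\in\mathbb{N}}$ and $(Y_n)_{n\in\mathbb{N}}$ be sequences of Banach spaces, and for each $n\in\mathbb{N}$ let $\varphi_n:X_n\to Y_n$ be a coarse equivalence (resp. a uniform homeomorphism; resp. a map which is simultaneously a homeomorphism and a coarse equivalence). Let $\mathcal{E}$ be a normalized $1$-unconditional basic sequence. Assume that $$\sup_n\lim_{t\to\infty}\frac{\omega_{\varphi_n}(t)}{t}<\infty\quad\text{and}\quad \inf_n\lim_{t\to\infty}\frac{\rho_{\varphi_n}(t)}{t}>0.$$ Then $(\oplus_nX_n)_{\mathcal{E}}$ and $(\oplus_nY_n)_{\mathcal{E}}$ are coarsely equivalent (resp. uniformly homeomorphic; resp. simultaneously homeomorphically and coarsely equivalent).
   Context: For a map $f:(M,d)\to(N,\partial)$ between metric spaces and $t\ge 0$, let $\omega_f(t)=\sup\{\partial(f(x),f(y)) : d(x,y)\le t\}$ and $\rho_f(t)=\inf\{\partial(f(x),f(y)) : d(x,y)\ge t\}$ (with $\inf\emptyset=\infty$). $f$ is coarse if $\omega_f(t)<\infty$ for all $t\ge 0$; expanding if $\lim_{t\to\infty}\rho_f(t)=\infty$; a coarse equivalence if it is coarse, expanding, and cobounded, i.e. $\sup_{y\in N}\partial(y,f(M))<\infty$. A uniform homeomorphism is a bijection $f$ with $f$ and $f^{-1}$ uniformly continuous. Two spaces are coarsely equivalent (resp. uniformly homeomorphic) if there is a coarse equivalence (resp. uniform homeomorphism) between them; they are simultaneously homeomorphically and coarsely equivalent if there is a single map between them which is both a homeomorphism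 (onto) and a coarse equivalence. If $\mathcal{E}=(e_n)_{n\in\mathbb{N}}$ is a $1$-unconditional basic sequence and $(X_n)_n$ are Banach spaces, $(\oplus_nX_n)_{\mathcal{E}}$ is the Banach space of sequences $(x_n)_n$, $x_n\in X_n$, for which $\sum_n\|x_n\|e_n$ converges, with norm $\|(x_n)_n\|=\left\|\sum_n\|x_n\|e_n\right\|$. Normalized means $\|e_n\|=1$ for all $n$. *)

(* Defs.v *)
From HB Require Import structures.
From mathcomp Require Import all_boot all_order all_algebra.
From mathcomp Require Import all_classical all_reals all_analysis.
From mathcomp Require Import ring lra.

Set Implicit Arguments.
Unset Strict Implicit.
Unset Printing Implicit Defensive.

Import Order.TTheory GRing.Theory Num.Theory.
Import numFieldNormedType.Exports.

Local Open Scope classical_set_scope.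
Local Open Scope ring_scope.

(* Metric notions are stated for maps between normed spaces, with the distance
   [`|x - y|]. *)
Section moduli.
Context {R : realType} {M N : normedModType R}.
Implicit Types (f : M -> N) (t : R).

Definition omega f t : \bar R :=
  ereal_sup [set (`|f z.1 - f z.2|)%:E | z in [set z : M * M | `|z.1 - z.2| <= t]].

(* [ereal_inf set0 = +oo] *)
Definition rho f t : \bar R :=
  ereal_inf [set (`|f z.1 - f z.2|)%:E | z in [set z : M * M | t <= `|z.1 - z.2|]].

Definition coarse f := forall t, 0 <= t -> (omega f t < +oo)%E.

Definition expanding f := rho f t @[t --> +oo] --> +oo%E.

Definition cobounded f :=
  (ereal_sup [set ereal_inf [set (`|y - f x|)%:E | x in [set: M]]
             | y in [set: N]] < +oo)%E.

Definition coarse_equivalence f := [/\ coarse f, expanding f & cobounded f].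

Definition uniform_homeomorphism f := exists g : N -> M,
  [/\ cancel f g, cancel g f, unif_continuous f & unif_continuous g].

Definition homeomorphism f := exists g : N -> M,
  [/\ cancel f g, cancel g f, continuous f & continuous g].

End moduli.

Section equivalences.
Context {R : realType} (M N : normedModType R).

Definition coarsely_equivalent := exists f : M -> N, coarse_equivalence f.

Definition uniformly_homeomorphic := exists f : M -> N, uniform_homeomorphism f.

Definition homeomorphically_and_coarsely_equivalent :=
  exists f : M -> N, homeomorphism f /\ coarse_equivalence f.

End equivalences.

Section basic_sequences.
Context {R : realType} {E : completeNormedModType R}.
Implicit Types (e : nat -> E) (a b : nat -> R).

Definition lin_span e : set E :=
  [set x | exists n a, x = \sum_(0 <= i < n) a i *: e i].

(* a Schauder basis of its closed linear span *)
Definition basic_sequence e := forall x, closure (lin_span e) x ->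
  exists! a, series (fun i => a i *: e i) @ \oo --> x.

Definition one_unconditional e := forall n a (s : nat -> bool),
  `|\sum_(0 <= i < n) ((-1) ^+ s i * a i) *: e i| <=
  `|\sum_(0 <= i < n) a i *: e i|.

Definition one_unconditional_basic_sequence e :=
  basic_sequence e /\ one_unconditional e.

Definition normalized e := forall n, `|e n| = 1.

Lemma one_unconditional_step e : one_unconditional e ->
  forall n a b k, (forall i, i != k -> a i = b i) -> `|a k| <= `|b k| ->
  `|\sum_(0 <= i < n) a i *: e i| <= `|\sum_(0 <= i < n) b i *: e i|.
Proof.
move=> ue n a b k ab abk.
have [r [r1 akE]] : exists r, `|r| <= 1 /\ a k = r * b k.
  have [bk0|bk0] := eqVneq (b k) 0.
    exists 0; rewrite normr0 ler01 mul0r; split => //.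
    by apply/eqP; rewrite -normr_le0; move: abk; rewrite bk0 normr0.
  exists (a k / b k); rewrite divfK//; split => //.
  by rewrite normrM normfV ler_pdivrMr ?normr_gt0// mul1r.
have /= bE := ue n b (fun i => i == k).
set B := `|\sum_(0 <= i < n) b i *: e i| in bE *.
have -> : \sum_(0 <= i < n) a i *: e i =
    ((1 + r) / 2) *: (\sum_(0 <= i < n) b i *: e i) +
    ((1 - r) / 2) *: (\sum_(0 <= i < n) ((-1) ^+ (i == k) * b i) *: e i).
  rewrite !scaler_sumr -big_split/=; apply: eq_bigr => i _.
  rewrite !scalerA -scalerDl; congr (_ *: _).
  have [->|ik] := eqVneq i k; first by rewrite akE expr1; field.
  by rewrite ab// expr0; field.
rewrite (le_trans (ler_normD _ _))// (normrZ ((1 + r) / 2)) (normrZ ((1 - r) / 2)).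
move: r1; rewrite ler_norml => /andP[r1 r2].
rewrite ger0_norm; last by lra.
rewrite ger0_norm; last by lra.
rewrite -/B.
rewrite [leRHS](_ : B = (1 + r) / 2 * B + (1 - r) / 2 * B); last by field.
rewrite lerD2l; apply: ler_wpM2l => //; lra.
Qed.

Lemma one_unconditional_le e : one_unconditional e ->
  forall m n a b,
  (forall i, (m <= i < n)%N -> `|a i| <= `|b i|) ->
  `|\sum_(m <= i < n) a i *: e i| <= `|\sum_(0 <= i < n) b i *: e i|.
Proof.
move=> ue m n a b ab.
pose a' i := if (m <= i < n)%N then a i else 0.
have -> : \sum_(m <= i < n) a i *: e i = \sum_(0 <= i < n) a' i *: e i.
  have [mn|nm] := leqP m n; last first.
    rewrite big_geq 1?ltnW// big_nat big1// => i /andP[_ iltn].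
    by rewrite /a' leqNgt (ltn_trans iltn nm) scale0r.
  rewrite (big_cat_nat (leq0n m) mn)/= [X in _ = X + _]big_nat.
  rewrite [X in _ = X + _]big1 ?add0r; last first.
    by move=> i /andP[_ im]; rewrite /a' leqNgt im scale0r.
  by rewrite !big_nat; apply: eq_bigr => i mi; rewrite /a' mi.
have {}ab i : (i < n)%N -> `|a' i| <= `|b i|.
  move=> iltn; rewrite /a'; case: ifPn => [/ab//|_].
  by rewrite normr0.
pose c k i := if (i < k)%N then a' i else b i.
suff H k : (k <= n)%N -> `|\sum_(0 <= i < n) c k i *: e i| <=
    `|\sum_(0 <= i < n) b i *: e i|.
  apply: le_trans (H n (leqnn n)); rewrite le_eqVlt; apply/orP; left.
  apply/eqP; congr (`|_|); rewrite !big_nat; apply: eq_bigr => i /andP[_ iltn].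
  by rewrite /c iltn.
elim: k => [_|k ih kn]; first by rewrite /c.
apply: le_trans (ih (ltnW kn)).
apply: (@one_unconditional_step _ ue n _ _ k) => [i ik|].
  by rewrite /c ltnS leq_eqVlt (negbTE ik).
by rewrite /c ltnSn ltnn ab.
Qed.

Lemma one_unconditional_block e : one_unconditional e ->
  forall m n a b, (forall i, (m <= i < n)%N -> `|a i| <= `|b i|) ->
  `|\sum_(m <= i < n) a i *: e i| <= `|\sum_(m <= i < n) b i *: e i|.
Proof.
move=> ue m n a b ab.
have [nm|mn] := leqP n m; first by rewrite !big_geq// normr0.
pose b' i := if (m <= i)%N then b i else 0.
have -> : \sum_(m <= i < n) b i *: e i = \sum_(0 <= i < n) b' i *: e i.
  rewrite [in RHS](big_cat_nat (leq0n m) (ltnW mn))/= [X in _ = X + _]big_nat.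
  rewrite [X in _ = X + _]big1 ?add0r; last first.
    by move=> i /andP[_ im]; rewrite /b' leqNgt im scale0r.
  by rewrite !big_nat; apply: eq_bigr => i /andP[mi _]; rewrite /b' mi.
apply: one_unconditional_le => // i /[dup]/andP[mi _] /ab.
by rewrite /b' mi.
Qed.

Lemma basic_sequence_unique0 e : basic_sequence e -> forall a,
  series (fun i => a i *: e i) @ \oo --> (0 : E) -> a = (fun=> 0).
Proof.
move=> be a a0.
have s0 : lin_span e 0 by exists 0%N, (fun=> 0); rewrite big_geq.
have [b [_ ub]] := be 0 (subset_closure s0).
rewrite -(ub _ a0); apply: ub.
rewrite (_ : series _ = fun=> 0); first exact: cvg_cst.
by apply/funext => n; rewrite /series/= big1// => i _; rewrite scale0r.
Qed.

Lemma basic_sequence_neq0 e : basic_sequence e -> forall n, e n != 0.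
Proof.
move=> be n; apply/eqP => en0.
have : (fun i => (i == n)%:R : R) = (fun=> 0).
  apply: (basic_sequence_unique0 be).
  rewrite (_ : series _ = fun=> 0); first exact: cvg_cst.
  apply/funext => k; rewrite /series/= big1// => i _.
  by case: eqVneq => [->|_]; rewrite ?en0 ?scaler0// scale0r.
by move/(congr1 (@^~ n)); rewrite eqxx => /eqP; rewrite oner_eq0.
Qed.

End basic_sequences.

(* [banach_sum X he] is the E-sum of the spaces [X n]; its vector space structure
   needs the proof [he], which is therefore a parameter of the type. *)
Section banach_sum.
Context {R : realType} {E : completeNormedModType R}.
Variables (X : nat -> completeNormedModType R) (e : nat -> E).

Definition norm_series (x : forall n, X n) : nat -> E :=
  series (fun n => `|x n| *: e n).

Definition banach_sum (he : one_unconditional_basic_sequence e) : Type :=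
  {x : forall n, X n | cvgn (norm_series x)}.

Variable he : one_unconditional_basic_sequence e.
Local Notation S := (banach_sum he).
Implicit Types x y z : S.

Definition bsum_seq x : forall n, X n := sval x.

Lemma bsum_seq_inj x y : (forall n, bsum_seq x n = bsum_seq y n) -> x = y.
Proof.
case: x y => [x px] [y py] /= xy.
have {}xy : x = y by exact: functional_extensionality_dep.
by rewrite xy in px *; congr exist; exact: Prop_irrelevance.
Qed.

Lemma cvg_norm_series_le (u v w : forall n, X n) :
  cvgn (norm_series u) -> cvgn (norm_series v) ->
  (forall n, `|w n| <= `|u n| + `|v n|) -> cvgn (norm_series w).
Proof.
move=> /cvg_cauchy/cauchy_seriesP cu /cvg_cauchy/cauchy_seriesP cv uvw.
apply/cauchy_cvgP/cauchy_seriesP => eps eps0.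
have eps20 : 0 < eps / 2 by rewrite divr_gt0.
move: (cu _ eps20) (cv _ eps20); apply: filterS2 => -[m n]/= um vm.
apply: (@le_lt_trans _ _
  `|\sum_(m <= i < n) (`|u i| + `|v i|) *: e i|).
  apply: (one_unconditional_block he.2) => i _.
  by rewrite normr_id (le_trans (uvw i))// ger0_norm// addr_ge0.
under eq_bigr do rewrite scalerDl.
rewrite big_split/= (le_lt_trans (ler_normD _ _))//.
by rewrite [ltRHS]splitr ltrD.
Qed.

Lemma cvg_norm_seriesZ (u : forall n, X n) (k : R) :
  cvgn (norm_series u) -> cvgn (norm_series (fun n => k *: u n)).
Proof.
move=> cu; rewrite (_ : norm_series _ = fun n => `|k| *: norm_series u n).
  by apply: is_cvgZl_tmp.
apply/funext => n; rewrite /norm_series /series/= scaler_sumr.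
by apply: eq_bigr => i _; rewrite scalerA normrZ.
Qed.

Lemma cvg_norm_series0 : cvgn (norm_series (fun n => 0)).
Proof.
rewrite (_ : norm_series _ = fun=> 0); first exact: is_cvg_cst.
apply/funext => n; rewrite /norm_series /series/= big1// => i _.
by rewrite normr0 scale0r.
Qed.

Definition bsum_zero : S := exist _ (fun n => 0) cvg_norm_series0.

Definition bsum_scale (k : R) x : S :=
  exist _ (fun n => k *: bsum_seq x n) (@cvg_norm_seriesZ _ k (svalP x)).

Lemma cvg_norm_seriesN (u : forall n, X n) :
  cvgn (norm_series u) -> cvgn (norm_series (fun n => - u n)).
Proof.
suff -> : norm_series (fun n => - u n) = norm_series u by [].
by congr series; apply/funext => n; rewrite normrN.
Qed.

Definition bsum_opp x : S :=
  exist _ (fun n => - bsum_seq x n) (cvg_norm_seriesN (svalP x)).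

Definition bsum_add x y : S :=
  exist _ (fun n => bsum_seq x n + bsum_seq y n)
    (cvg_norm_series_le (svalP x) (svalP y)
       (fun n => ler_normD (bsum_seq x n) (bsum_seq y n))).

HB.instance Definition _ := gen_eqMixin S.
HB.instance Definition _ := gen_choiceMixin S.

Lemma bsum_addA : associative bsum_add.
Proof. by move=> x y z; apply: bsum_seq_inj => n; exact: addrA. Qed.

Lemma bsum_addC : commutative bsum_add.
Proof. by move=> x y; apply: bsum_seq_inj => n; exact: addrC. Qed.

Lemma bsum_add0 : left_id bsum_zero bsum_add.
Proof. by move=> x; apply: bsum_seq_inj => n; exact: add0r. Qed.

Lemma bsum_addN : left_inverse bsum_zero bsum_opp bsum_add.
Proof. by move=> x; apply: bsum_seq_inj => n; exact: addNr. Qed.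

HB.instance Definition _ :=
  GRing.isZmodule.Build S bsum_addA bsum_addC bsum_add0 bsum_addN.

Lemma bsum_scaleA a b x :
  bsum_scale a (bsum_scale b x) = bsum_scale (a * b) x.
Proof. by apply: bsum_seq_inj => n; exact: scalerA. Qed.

Lemma bsum_scale1 : left_id 1 bsum_scale.
Proof. by move=> x; apply: bsum_seq_inj => n; exact: scale1r. Qed.

Lemma bsum_scaleDr : right_distributive bsum_scale +%R.
Proof. by move=> a x y; apply: bsum_seq_inj => n; exact: scalerDr. Qed.

Lemma bsum_scaleDl x : {morph bsum_scale^~ x : a b / a + b}.
Proof. by move=> a b; apply: bsum_seq_inj => n; exact: scalerDl. Qed.

HB.instance Definition _ := GRing.Zmodule_isLmodule.Build R S
  bsum_scaleA bsum_scale1 bsum_scaleDr bsum_scaleDl.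

Definition bsum_norm x : R := `|limn (norm_series (bsum_seq x))|.

Lemma bsum_norm_cvg x :
  `|norm_series (bsum_seq x) n| @[n --> \oo] --> bsum_norm x.
Proof. by apply: cvg_norm; exact: (svalP x). Qed.

Arguments bsum_norm_cvg x : clear implicits.

Lemma nondecreasing_norm_series (u : forall n, X n) :
  nondecreasing_seq (fun n => `|norm_series u n|).
Proof.
move=> m n mn; rewrite /norm_series /series/=.
rewrite (_ : \sum_(0 <= k < m) `|u k| *: e k =
  \sum_(0 <= k < n) (if (k < m)%N then `|u k| else 0) *: e k); last first.
  rewrite (big_cat_nat (leq0n m) mn)/= [X in _ = _ + X]big_nat.
  rewrite [X in _ = _ + X]big1 ?addr0; last first.
    by move=> i /andP[mi _]; rewrite ltnNge mi scale0r.
  by rewrite !big_nat; apply: eq_bigr => i /andP[_ ->].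
apply: (one_unconditional_block he.2) => i _.
by case: ifPn => // _; rewrite normr0.
Qed.

Lemma norm_series_le_norm x n : `|norm_series (bsum_seq x) n| <= bsum_norm x.
Proof.
have cx := bsum_norm_cvg x; rewrite -(cvg_lim _ cx)//.
apply: (nondecreasing_cvgn_le (nondecreasing_norm_series (bsum_seq x))).
by apply/cvg_ex; eexists; exact: cx.
Qed.

Lemma bsum_norm_le x (c : R) :
  (forall n, `|norm_series (bsum_seq x) n| <= c) -> bsum_norm x <= c.
Proof.
move=> xc; have cx := bsum_norm_cvg x; rewrite -(cvg_lim _ cx)//.
apply: limr_le; first by apply/cvg_ex; eexists; exact: cx.
by apply: nearW.
Qed.

Lemma bsum_coord_le x n : `|bsum_seq x n| * `|e n| <= bsum_norm x.
Proof.
apply: le_trans (norm_series_le_norm x n.+1).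
rewrite -(@normr_id _ _ (bsum_seq x n)) -normrZ.
rewrite -(@big_nat1 _ 0 +%R n (fun i => `|bsum_seq x i| *: e i)).
have := @one_unconditional_le _ _ _ he.2 n n.+1
  (fun i => `|bsum_seq x i|) (fun i => `|bsum_seq x i|).
by apply.
Qed.

Lemma bsum_ler_normD x y : bsum_norm (x + y) <= bsum_norm x + bsum_norm y.
Proof.
apply: bsum_norm_le => n.
rewrite (le_trans _ (lerD (norm_series_le_norm x n) (norm_series_le_norm y n)))//.
rewrite (le_trans _ (ler_normD _ _))// /norm_series /series/= -big_split/=.
under [in leRHS]eq_bigr do rewrite -scalerDl.
apply: (one_unconditional_block he.2) => i _.
by rewrite normr_id ger0_norm ?addr_ge0// ler_normD.
Qed.

Lemma bsum_normrZ (k : R) x : bsum_norm (k *: x) = `|k| * bsum_norm x.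
Proof.
apply: (cvg_unique _ (bsum_norm_cvg (k *: x))) => //.
rewrite (_ : (fun n => `|norm_series (bsum_seq (k *: x)) n|) =
    fun n => `|k| * `|norm_series (bsum_seq x) n|).
  by apply: cvgMr; exact: bsum_norm_cvg.
apply/funext => n; rewrite /norm_series /series/= -[X in X * _]normr_id -normrZ.
rewrite scaler_sumr; congr (`|_|); apply: eq_bigr => i _.
by rewrite scalerA /= normrZ.
Qed.

Lemma bsum_norm0_eq0 x : bsum_norm x = 0 -> x = 0.
Proof.
move=> x0; apply: bsum_seq_inj => n; apply/eqP; rewrite -normr_le0.
have := bsum_coord_le x n; rewrite x0 pmulr_lle0// normr_gt0.
exact: basic_sequence_neq0 he.1 n.
Qed.

HB.instance Definition _ := Lmodule_isNormed.Build R S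
  bsum_ler_normD bsum_normrZ bsum_norm0_eq0.

Lemma bsum_normE x : `|x| = `|limn (series (fun n => `|bsum_seq x n| *: e n))|.
Proof. by []. Qed.

Lemma bsum_complete (F : set_system S) : ProperFilter F -> cauchy F -> cvg F.
Proof.
move=> FF Fc.
have Fsmall (eps : R) : 0 < eps ->
    exists2 A, F A & forall x y, A x -> A y -> `|x - y| <= eps.
  move=> eps0.
  have /cauchyP/(_ (eps / 2)) := Fc.
  rewrite divr_gt0// => /(_ isT)[z Fz].
  exists (ball z (eps / 2)) => // x y; rewrite -ball_normE/= => zx zy.
  rewrite (_ : x - y = (z - y) - (z - x)); last by rewrite opprB [RHS]addrC addrA subrK.
  by rewrite (le_trans (ler_normB _ _))// [leRHS]splitr lerD// ltW.
have cn n : cvg ((fun x => bsum_seq x n) @ F).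
  apply: cauchy_cvg; apply/cauchy_exP => eps eps0.
  have en0 : 0 < `|e n| by rewrite normr_gt0 (basic_sequence_neq0 he.1).
  have [|A FA Ae] := Fsmall (eps / 2 * `|e n|).
    by rewrite mulr_gt0// divr_gt0.
  have [x Ax] := filter_ex FA.
  exists (bsum_seq x n); rewrite /fmap/=; apply: filterS FA => y Ay /=.
  rewrite -ball_normE/= (@le_lt_trans _ _ (eps / 2))//; last first.
    by rewrite ltr_pdivrMr// mulr2n mulrDr mulr1 ltrDl.
  rewrite -(ler_pM2r en0).
  by rewrite (le_trans (bsum_coord_le (x - y) n))// Ae.
pose y n : X n := lim ((fun x => bsum_seq x n) @ F).
have cy n : (fun x => bsum_seq x n) @ F --> y n by exact: cn.
have block (eps : R) (A : set S) : F A ->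
    (forall x z, A x -> A z -> `|x - z| <= eps) -> forall x, A x ->
    forall n, `|norm_series (fun i => bsum_seq x i - y i) n| <= eps.
  move=> FA Ae x Ax n.
  have cvx : (fun z => `|norm_series (fun i => bsum_seq x i - bsum_seq z i) n|)
      @ F --> `|norm_series (fun i => bsum_seq x i - y i) n|.
    apply: cvg_norm; apply: (cvg_big add_continuous) => i _.
    apply: cvgZr_tmp; apply: cvg_norm; apply: cvgB; last exact: cy.
    exact: cvg_cst.
  rewrite -(cvg_lim _ cvx)//.
  apply: limr_le; first by apply/cvg_ex; eexists; exact: cvx.
  apply: filterS FA => z Az.
  exact: le_trans (norm_series_le_norm (x - z) n) (Ae _ _ Ax Az).
have yS : cvgn (norm_series y).
  apply/cauchy_cvgP/cauchy_seriesP => eps eps0.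
  have eps40 : 0 < eps / 4 by rewrite divr_gt0.
  have [A FA Ae] := Fsmall _ eps40.
  have [x Ax] := filter_ex FA.
  have /cvg_cauchy/cauchy_seriesP/(_ _ eps40) := svalP x.
  apply: filterS => -[m n]/= xmn.
  apply: (@le_lt_trans _ _ `|\sum_(m <= i < n)
      (`|sval x i| + `|bsum_seq x i - y i|) *: e i|).
    apply: (one_unconditional_block he.2) => i _.
    rewrite normr_id ger0_norm ?addr_ge0//.
    rewrite -[in leLHS](subrK (sval x i) (y i)) addrC.
    by rewrite (le_trans (ler_normD _ _))// lerD2l distrC.
  under eq_bigr do rewrite scalerDl.
  rewrite big_split/= (le_lt_trans (ler_normD _ _))//.
  apply: (@lt_le_trans _ _ (eps / 4 + eps / 4)); last by lra.
  rewrite ltr_leD//; apply: le_trans (block _ _ FA Ae _ Ax n).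
  by apply: (one_unconditional_le he.2) => i _.
apply/cvg_ex; exists (exist _ y yS : S).
apply/cvgrPdist_le => eps eps0.
have [A FA Ae] := Fsmall _ eps0.
apply: (filterS _ FA) => x Ax.
by rewrite distrC; apply: bsum_norm_le => n; exact: (block _ _ FA Ae _ Ax n).
Qed.

HB.instance Definition _ := Uniform_isComplete.Build S bsum_complete.

End banach_sum.

(* Main.v *)
Require Import Defs.
From HB Require Import structures.
From mathcomp Require Import all_boot all_order all_algebra.
From mathcomp Require Import all_classical all_reals all_analysis.
From mathcomp Require Import ring lra.

Set Implicit Arguments.
Unset Strict Implicit.
Unset Printing Implicit Defensive.

Import Order.TTheory GRing.Theory Num.Theory.
Import numFieldNormedType.Exports.

Local Open Scope classical_set_scope.
Local Open Scope ring_scope.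

(** The equivalence between the sums acts coordinatewise, by rescaled copies of
    the maps [phi n].

    Fix [L] above all limit slopes of [omega (phi n)] and [c > 0] below all limit
    slopes of [rho (phi n)]. Each [phi n] is then Lipschitz and expansive up to an
    additive defect [D n]: [`|phi n x - phi n y| <= L * `|x - y| + D n], and
    [`|x - y| <= c^-1 * `|phi n x - phi n y| + D n]. The upper estimate needs the
    quotient [omega (phi n) t / t] to converge, so that its limit carries
    information; this is Fekete's lemma ([is_cvg_omega_div]). The slopes are
    uniform in [n], but the defects need not be bounded. Replacing [phi n] by
    [psi n x = s^-1 *: (phi n (s *: x) - phi n 0)] divides the defect by [s] and
    preserves the slopes, so a large scale [s], depending on [n], reduces the
    defect to [2^-n] ([exists_scales]); if [phi n] is cobounded, every point can
    moreover be brought within [2^-n] of the image of [psi n].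

    Since the basic sequence is unconditional and normalized, coordinatewise
    estimates with summable defects give estimates for the norms of the sums
    ([bsum_norm_dominated]). Hence [x |-> (psi n (x n))_n] is well defined,
    Lipschitz and expansive with defect [2], and when the maps are cobounded every
    point is within [2] of its image: it is a coarse equivalence. For continuity
    ([bsum_map_near]), the defects of all coordinates beyond a large [N] add up to
    little, while the finitely many others are controlled by the continuity of the
    [psi n]. For bijections, the expansiveness of [psi n] is the Lipschitz
    estimate of its inverse, and so the inverses define a map between the sums to
    which the same continuity argument applies. *)

(** * Moduli of maps between normed spaces *)

Section moduli_bounds.
Context {R : realType} {M N : normedModType R}.
Implicit Types (f : M -> N) (s t c C D K L : R) (x y : M).

Definition coarse_lipschitz f L D :=
  forall x y, `|f x - f y| <= L * `|x - y| + D.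

Definition coarse_expansive f K D :=
  forall x y, `|x - y| <= K * `|f x - f y| + D.

Lemma omega_ub f x y t : `|x - y| <= t -> ((`|f x - f y|)%:E <= omega f t)%E.
Proof. by move=> xyt; apply: ereal_sup_ubound; exists (x, y). Qed.

Lemma omega_le f t C : (forall x y, `|x - y| <= t -> `|f x - f y| <= C) ->
  (omega f t <= C%:E)%E.
Proof.
by move=> fC; apply: ge_ereal_sup => _ [[x y] /= xyt <-]; rewrite lee_fin fC.
Qed.

Lemma rho_lb f x y t : t <= `|x - y| -> (rho f t <= (`|f x - f y|)%:E)%E.
Proof. by move=> xyt; apply: ereal_inf_lbound; exists (x, y). Qed.

Lemma omega_fineK f t : coarse f -> 0 <= t -> omega f t = (fine (omega f t))%:E.
Proof.
move=> cf t0; rewrite fineK// ge0_fin_numE; first exact: cf.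
rewrite (le_trans _ (@omega_ub f 0 0 t _)) ?lee_fin//.
by rewrite subrr normr0.
Qed.

Lemma fine_omega_ub f x y t : coarse f -> `|x - y| <= t ->
  `|f x - f y| <= fine (omega f t).
Proof.
move=> cf xyt; rewrite -lee_fin -omega_fineK//; first exact: omega_ub.
exact: le_trans xyt.
Qed.

(** A segment of length [k * s] is cut into [k] pieces of length [s]. *)
Lemma chain_le f s c : (forall x y, `|x - y| <= s -> `|f x - f y| <= c) ->
  forall k x y, `|x - y| <= k%:R * s -> `|f x - f y| <= k%:R * c.
Proof.
move=> fc; elim=> [|k ih] x y.
  rewrite !mul0r normr_le0 subr_eq0 => /eqP ->.
  by rewrite subrr normr0.
set d := x - y => dk.
have k1 : (k.+1%:R : R) != 0 by rewrite pnatr_eq0.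
have yzE : y + k.+1%:R^-1 *: d - y = k.+1%:R^-1 *: d.
  by rewrite addrAC subrr add0r.
have xzE : x - (y + k.+1%:R^-1 *: d) = (k%:R / k.+1%:R) *: d.
  rewrite opprD addrA -/d -[X in X - _]scale1r -scalerBl; congr (_ *: _).
  by rewrite -natr1; field; rewrite natr1.
have {yzE} yz : `|f (y + k.+1%:R^-1 *: d) - f y| <= c.
  apply: fc; rewrite yzE normrZ ger0_norm ?invr_ge0//.
  by rewrite mulrC ler_pdivrMr ?ltr0n// mulrC.
have {xzE} xz : `|f x - f (y + k.+1%:R^-1 *: d)| <= k%:R * c.
  apply: ih; rewrite xzE normrZ ger0_norm ?divr_ge0//.
  rewrite -mulrA ler_wpM2l// mulrC ler_pdivrMr ?ltr0n//.
  by rewrite mulrC.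
rewrite -natr1 mulrDl mul1r.
rewrite (le_trans (ler_distD (f (y + k.+1%:R^-1 *: d)) _ _))//.
exact: lerD.
Qed.

(** Fekete's lemma for the modulus [omega f], which is subadditive because a
    segment of a normed space can be cut into short ones. *)
Lemma is_cvg_omega_div f : coarse f ->
  cvg ((omega f t * (t^-1)%:E)%E @[t --> +oo%R]).
Proof.
move=> cf; pose w t := fine (omega f t).
have w0 t : 0 <= t -> 0 <= w t.
  move=> t0; rewrite (le_trans _ (@fine_omega_ub f 0 0 t cf _))//.
  by rewrite subrr normr0.
have w_le t k s : 0 <= t -> t <= k%:R * s -> w t <= k%:R * w s.
  move=> t0 tks; rewrite -lee_fin /w -omega_fineK//; apply: omega_le => x y xyt.
  apply: (chain_le (s := s)); last exact: le_trans tks.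
  by move=> x' y'; exact: fine_omega_ub.
pose A := [set w t / t | t in [set t | 0 < t]].
have A0 : lbound A 0.
  by move=> _ [t /= t0 <-]; rewrite divr_ge0 ?w0// ltW.
have infA : has_inf A.
  by split; [exists (w 1 / 1), 1 => /=; first exact: ltr01|exists 0].
apply/cvg_ex; exists (inf A)%:E; apply: cvg_EFin.
  near=> t; have t0 : 0 <= t by near: t; apply: nbhs_pinfty_ge; exact: num_real.
  by rewrite omega_fineK.
apply/cvgrPdist_le => eps eps0.
have [_ [s /= s0 <-] sA] := inf_adherent (divr_gt0 eps0 (ltr0n R 2)) infA.
near=> t.
have t0 : 0 < t by near: t; exact: nbhs_pinfty_gt.
have ts : w s / (eps / 2) <= t.
  by near: t; apply: nbhs_pinfty_ge; exact: num_real.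
have -> : fine (omega f t * t^-1%:E)%E = w t / t.
  by rewrite omega_fineK// ltW.
have At : inf A <= w t / t by apply: (ge_inf infA.2); exists t.
rewrite distrC ger0_norm ?subr_ge0// lerBlDl.
pose k := Num.truncn (t / s).
have tk : t <= k.+1%:R * s by rewrite -ler_pdivrMr// ltW// truncnS_gt.
have ks : k%:R <= t / s by rewrite truncn_le divr_ge0// ltW.
rewrite ler_pdivrMr// (le_trans (w_le _ _ _ (ltW t0) tk))//.
rewrite -natr1 mulrDl mul1r.
have h1 : k%:R * w s <= t * (w s / s).
  by rewrite mulrCA [leRHS]mulrC ler_wpM2r// ?w0// ltW.
have h2 : w s <= t * (eps / 2) by rewrite -ler_pdivrMr// divr_gt0.
have h3 : t * (w s / s) <= t * (inf A + eps / 2) by rewrite ler_wpM2l// ltW.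
by nra.
Unshelve. all: by end_near. Qed.

(** Beyond some scale [t] the modulus is at most [L] times its argument; below
    it, [omega f t] bounds the variation, hence the additive defect [L * t]. *)
Lemma coarse_lipschitz_omega f L : coarse f ->
  (lim ((omega f t * (t^-1)%:E)%E @[t --> +oo%R]) < L%:E)%E ->
  exists D, coarse_lipschitz f L D.
Proof.
move=> cf fL; have : \forall t \near +oo%R, (omega f t * (t^-1)%:E < L%:E)%E.
  exact: (is_cvg_omega_div cf (open_ereal_lt' fL)).
move=> fLt; have [t [t0]] : exists t, 0 < t /\
    forall s, t <= s -> (omega f s * (s^-1)%:E < L%:E)%E.
  case: fLt => t [_ fLt]; exists (Num.max 1 (t + 1)); split.
    by rewrite lt_max ltr01.
  by move=> s; rewrite ge_max => /andP[_ ts]; apply: fLt; lra.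
move=> {}fLt; exists (L * t) => x y.
have xyt : 0 < `|x - y| + t by rewrite ltr_wpDl.
rewrite -mulrDr -lee_fin.
apply: (@le_trans _ _ (omega f (`|x - y| + t))).
  by apply: omega_ub; rewrite lerDl ltW.
by rewrite EFinM -lee_pdivrMr// ltW// fLt// lerDr.
Qed.

(** Points closer than the scale at which [rho f] starts to dominate [c] times
    its argument are absorbed by the additive defect. *)
Lemma coarse_expansive_rho f c : 0 < c ->
  (c%:E < lim ((rho f t * (t^-1)%:E)%E @[t --> +oo%R]))%E ->
  exists D, coarse_expansive f c^-1 D.
Proof.
move=> c0 fc.
(* a divergent quotient has the default limit [0], which is not above [c] *)
have cvf : cvg ((rho f t * (t^-1)%:E)%E @[t --> +oo%R]).
  apply: contrapT => /dvgP flim; move: fc; rewrite flim.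
  by rewrite lte_fin ltNge ltW.
have : \forall t \near +oo%R, (c%:E < rho f t * (t^-1)%:E)%E.
  exact: (cvf _ (open_ereal_gt' fc)).
move=> fct; have [t [t0]] : exists t, 0 < t /\
    forall s, t <= s -> (c%:E < rho f s * (s^-1)%:E)%E.
  case: fct => t [_ fct]; exists (Num.max 1 (t + 1)); split.
    by rewrite lt_max ltr01.
  by move=> s; rewrite ge_max => /andP[_ ts]; apply: fct; lra.
move=> {}fct; exists t => x y.
have [xyt|txy] := leP `|x - y| t.
  by rewrite (le_trans xyt)// lerDr mulr_ge0// invr_ge0 ltW.
have xy0 : 0 < `|x - y| by exact: lt_trans txy.
have : (c%:E * `|x - y|%:E <= (`|f x - f y|)%:E)%E.
  apply: (@le_trans _ _ (rho f `|x - y|)); last exact: rho_lb.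
  by rewrite -lee_pdivlMr// ltW// fct// ltW.
rewrite -EFinM lee_fin => cxy.
rewrite (@le_trans _ _ (c^-1 * `|f x - f y|)) ?lerDl ?(ltW t0)//.
by rewrite [leRHS]mulrC ler_pdivlMr// mulrC.
Qed.

Lemma coarse_lipschitz_coarse f L D : 0 <= L ->
  coarse_lipschitz f L D -> coarse f.
Proof.
move=> L0 fLD t t0; apply: (@le_lt_trans _ _ (L * t + D)%:E); last exact: ltry.
apply: omega_le => x y xyt; rewrite (le_trans (fLD x y))//.
by rewrite lerD2r ler_wpM2l.
Qed.

Lemma coarse_expansive_expanding f K D : 0 < K ->
  coarse_expansive f K D -> expanding f.
Proof.
move=> K0 fKD; apply/cvgeyPge => A; near=> t.
apply: le_ereal_inf_tmp => _ [[x y] /= txy <-]; rewrite lee_fin.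
have : K * A + D <= t by near: t; apply: nbhs_pinfty_ge; exact: num_real.
move=> At; have := le_trans At (le_trans txy (fKD x y)).
by rewrite lerD2r ler_pM2l.
Unshelve. all: by end_near. Qed.

Lemma cobounded_net f C :
  (forall y : N, exists x, `|y - f x| <= C) -> cobounded f.
Proof.
move=> fC; apply: (@le_lt_trans _ _ C%:E); last exact: ltry.
apply: ge_ereal_sup => _ [y _ <-]; apply: ge_ereal_inf.
by have [x xC] := fC y; exists (`|y - f x|)%:E; [exists x|rewrite lee_fin].
Qed.

Lemma cobounded_exists f : cobounded f ->
  exists C, forall y : N, exists x, `|y - f x| <= C.
Proof.
move=> bf.
pose B := ereal_sup [set ereal_inf [set (`|y - f x|)%:E | x in [set: M]]
             | y in [set: N]].
have [C BC] : exists C, (B < C%:E)%E.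
  move: bf; rewrite /cobounded -/B; case: B => [r _|//|_].
  - by exists (r + 1); rewrite lte_fin ltrDl.
  - by exists 0; exact: ltNyr.
exists C => y.
have : (ereal_inf [set (`|y - f x|)%:E | x in [set: M]] < C%:E)%E.
  by apply: le_lt_trans BC; apply: ereal_sup_ubound; exists y.
by move=> /ereal_inf_lt[_ [x _ <-]]; rewrite lte_fin => /ltW; exists x.
Qed.

End moduli_bounds.

(** * Uniform continuity in normed spaces *)

Section uniform_continuity.
Context {R : realType}.
Implicit Types M N : normedModType R.

Lemma near_entourage_norm M (P : set (M * M)) :
  (\forall z \near entourage, P z) <->
  exists2 d : R, 0 < d & forall x y, `|x - y| <= d -> P (x, y).
Proof.
split.
  rewrite /prop_near1 /= -entourage_from_ballE => -[d /= d0 dP].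
  exists (d / 2); first by rewrite divr_gt0.
  move=> x y xyd; apply: dP => /=; rewrite -ball_normE/=.
  by rewrite (le_lt_trans xyd)// ltr_pdivrMr// ltr_pMr// ltr1n.
case=> d d0 dP; rewrite /prop_near1 /= -entourage_from_ballE.
exists d => //= -[x y] /=; rewrite -ball_normE/= => /ltW; exact: dP.
Qed.

Lemma unif_continuous_normP M N (f : M -> N) :
  unif_continuous f <-> forall eps : R, 0 < eps ->
    \forall z \near entourage, `|f z.1 - f z.2| <= eps.
Proof.
split=> [uf eps eps0|uf A].
  have : \forall z \near (@entourage N), `|z.1 - z.2| <= eps.
    by apply/near_entourage_norm; exists eps.
  by move=> /uf.
move=> /near_entourage_norm[eps eps0 epsA].
by apply: filterS (uf _ eps0) => -[x y] /= /epsA.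
Qed.

(** Two points at distance at most [t] are joined by a chain of [k] steps of
    length at most [d], and [k] depends only on [t] and [d]. *)
Lemma unif_continuous_coarse M N (f : M -> N) : unif_continuous f -> coarse f.
Proof.
move=> /unif_continuous_normP/(_ _ ltr01)/near_entourage_norm[d d0 fd] t t0.
pose k := (Num.truncn (t / d)).+1.
apply: (@le_lt_trans _ _ (k%:R * 1)%:E); last exact: ltry.
apply: omega_le => x y xyt; apply: (@chain_le _ _ _ f d 1 fd).
by rewrite (le_trans xyt)// -ler_pdivrMr// ltW// truncnS_gt.
Qed.

End uniform_continuity.

(** * Rescaling *)

Section rescaling.
Context {R : realType} {M N : normedModType R}.
Variables (s : R) (f : M -> N).
Hypothesis s0 : 0 < s.
Implicit Types g : N -> M.

(** Subtracting [f 0] makes the map fix the origin; a sequence of such maps with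
    summable defects then sends summable sequences to summable ones. *)
Definition rescale (x : M) : N := s^-1 *: (f (s *: x) - f 0).

Definition rescale_inv g (u : N) : M := s^-1 *: g (s *: u + f 0).

Lemma rescale0 : rescale 0 = 0.
Proof. by rewrite /rescale scaler0 subrr scaler0. Qed.

Lemma rescaleB x y : rescale x - rescale y = s^-1 *: (f (s *: x) - f (s *: y)).
Proof. by rewrite -scalerBr; congr (_ *: _); rewrite opprB addrA subrK. Qed.

Lemma norm_rescaleB x y :
  `|rescale x - rescale y| = s^-1 * `|f (s *: x) - f (s *: y)|.
Proof. by rewrite rescaleB normrZ gtr0_norm// invr_gt0. Qed.

Lemma norm_scaleB (x y : M) : `|s *: x - s *: y| = s * `|x - y|.
Proof. by rewrite -scalerBr normrZ gtr0_norm. Qed.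

(** Rescaling divides the additive defect by [s] and keeps the slope, which is
    why only the slopes need to be uniform along the family of maps. *)
Lemma coarse_lipschitz_rescale L D :
  coarse_lipschitz f L D -> coarse_lipschitz rescale L (D / s).
Proof.
move=> fLD x y; rewrite norm_rescaleB ler_pdivrMl//.
rewrite (le_trans (fLD _ _))// norm_scaleB mulrDr mulrCA.
by rewrite [s * (D / s)]mulrC divfK// gt_eqF.
Qed.

Lemma coarse_expansive_rescale K D :
  coarse_expansive f K D -> coarse_expansive rescale K (D / s).
Proof.
move=> fKD x y; rewrite norm_rescaleB -(ler_pM2l s0) -norm_scaleB.
rewrite (le_trans (fKD _ _))// mulrDr [s * (D / s)]mulrC divfK ?gt_eqF//.
by rewrite mulrCA [s * _]mulrA divff ?gt_eqF// mul1r.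
Qed.

Lemma rescale_net C : (forall y, exists x, `|y - f x| <= C) ->
  forall y, exists x, `|y - rescale x| <= C / s.
Proof.
move=> fC y; have [x xC] := fC (s *: y + f 0); exists (s^-1 *: x).
rewrite /rescale scalerA divff ?gt_eqF// scale1r.
have -> : y - s^-1 *: (f x - f 0) = s^-1 *: (s *: y + f 0 - f x).
  rewrite -addrA [RHS]scalerDr scalerA mulVf ?gt_eqF// scale1r; congr (_ + _).
  by rewrite -scalerN opprB.
by rewrite normrZ gtr0_norm ?invr_gt0// mulrC ler_pM2r// invr_gt0.
Qed.

Lemma rescaleK g : cancel f g -> cancel rescale (rescale_inv g).
Proof.
move=> fg x; rewrite /rescale /rescale_inv scalerA divff ?gt_eqF// scale1r subrK.
by rewrite fg scalerA mulVf ?gt_eqF// scale1r.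
Qed.

Lemma rescale_invK g : cancel g f -> cancel (rescale_inv g) rescale.
Proof.
move=> gf u; rewrite /rescale /rescale_inv scalerA divff ?gt_eqF// scale1r gf.
by rewrite addrK scalerA mulVf ?gt_eqF// scale1r.
Qed.

Lemma continuous_rescale : continuous f -> continuous rescale.
Proof.
move=> cf x; apply: cvgZl_tmp; apply: cvgB; last exact: cvg_cst.
apply: (@continuous_comp _ _ _ ( *:%R s) f); last exact: cf.
exact: scaler_continuous.
Qed.

Lemma continuous_rescale_inv g : continuous g -> continuous (rescale_inv g).
Proof.
move=> cg u; apply: cvgZl_tmp.
apply: (@continuous_comp _ _ _ (fun u => s *: u + f 0) g); last exact: cg.
by apply: cvgD; [exact: scaler_continuous|exact: cvg_cst].
Qed.

Lemma unif_continuous_rescale : unif_continuous f -> unif_continuous rescale.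
Proof.
move=> /unif_continuous_normP uf; apply/unif_continuous_normP => eps eps0.
have /uf/near_entourage_norm[d d0 fd] := mulr_gt0 s0 eps0.
apply/near_entourage_norm; exists (d / s); first by rewrite divr_gt0.
move=> x y /= xyd; rewrite norm_rescaleB ler_pdivrMl//.
by apply: fd; rewrite norm_scaleB mulrC -ler_pdivlMr.
Qed.

Lemma unif_continuous_rescale_inv g :
  unif_continuous g -> unif_continuous (rescale_inv g).
Proof.
move=> /unif_continuous_normP ug; apply/unif_continuous_normP => eps eps0.
have /ug/near_entourage_norm[d d0 gd] := mulr_gt0 s0 eps0.
apply/near_entourage_norm; exists (d / s); first by rewrite divr_gt0.
move=> u v /= uvd; rewrite /rescale_inv -scalerBr normrZ gtr0_norm ?invr_gt0//.
rewrite ler_pdivrMl//; apply: gd.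
rewrite opprD addrACA subrr addr0 -scalerBr normrZ gtr0_norm//.
by rewrite mulrC -ler_pdivlMr.
Qed.

End rescaling.

(** * Summable weights *)

Section weights.
Context {R : realType}.

Definition weight (n : nat) : R := 2^-1 ^+ n.

Lemma weight_gt0 n : 0 < weight n.
Proof. by rewrite exprn_gt0// invr_gt0. Qed.

Lemma weight_ge0 n : 0 <= weight n.
Proof. exact/ltW/weight_gt0. Qed.

Lemma sum_weight_le m n : \sum_(m <= i < n) weight i <= 2 * weight m.
Proof.
have [nm|mn] := leqP n m; first by rewrite big_geq// mulr_ge0// weight_ge0.
suff -> : \sum_(m <= i < n) weight i = 2 * weight m - 2 * weight n.
  by rewrite gerBl mulr_ge0// weight_ge0.
rewrite (eq_bigr (fun i => (- (2 * weight i.+1)) - (- (2 * weight i)))).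
  by rewrite telescope_sumr 1?ltnW// opprK addrC.
by move=> i _; rewrite opprK /weight exprS; field.
Qed.

Lemma sum_weight_tail_le m n :
  \sum_(0 <= i < n) (if (m <= i)%N then weight i else 0) <= 2 * weight m.
Proof.
rewrite -big_mkcond/= (_ : \sum_(0 <= i < n | _) _ = \sum_(m <= i < n) weight i).
  exact: sum_weight_le.
by rewrite (@big_nat_widenl _ _ _ m 0).
Qed.

Lemma weight_small (eps : R) : 0 < eps -> exists n, weight n <= eps.
Proof.
move=> eps0; have : weight @ \oo --> 0.
  by apply: cvg_expr; rewrite ger0_norm ?invr_ge0// invf_lt1// ltr1n.
move=> /cvgrPdist_le/(_ _ eps0)[n _ /(_ n (leqnn n))] /=.
by rewrite sub0r normrN ger0_norm ?weight_ge0//; exists n.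
Qed.

End weights.

(** * Coordinatewise domination *)

Section domination.
Context {R : realType} {E : completeNormedModType R} {e : nat -> E}.
Variables (he : one_unconditional_basic_sequence e) (ne : normalized e).
Implicit Types (X Y : nat -> completeNormedModType R) (a b : nat -> R).

Lemma norm_sum_basis_le a n : (forall i, 0 <= a i) ->
  `|\sum_(0 <= i < n) a i *: e i| <= \sum_(0 <= i < n) a i.
Proof.
move=> a0; rewrite (le_trans (ler_norm_sum _ _ _))//.
by apply: ler_sum => i _; rewrite normrZ ne mulr1 ger0_norm.
Qed.

(** Unconditionality makes the norm monotone in the moduli of the coordinates,
    and normalization bounds the contribution of [b] by its [l^1] norm. *)
Lemma norm_series_dominated X Y (x : forall n, X n) (y : forall n, Y n) A b C :
  0 <= A -> (forall n, 0 <= b n) ->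
  (forall n, `|y n| <= A * `|x n| + b n) ->
  (forall n, \sum_(0 <= i < n) b i <= C) ->
  forall n, `|norm_series e y n| <= A * `|norm_series e x n| + C.
Proof.
move=> A0 b0 xy bC n; rewrite /norm_series /series/=.
apply: (@le_trans _ _ `|\sum_(0 <= i < n) (A * `|x i| + b i) *: e i|).
  apply: (one_unconditional_block he.2) => i _.
  by rewrite normr_id ger0_norm// addr_ge0// mulr_ge0.
under [X in `|X| <= _]eq_bigr do rewrite scalerDl -scalerA.
rewrite big_split/= -scaler_sumr (le_trans (ler_normD _ _))//.
rewrite normrZ ger0_norm// lerD2l.
by rewrite (le_trans (norm_sum_basis_le _ b0)).
Qed.

Lemma cvg_norm_series_dominated X Y (x : forall n, X n) (y : forall n, Y n) A b :
  0 <= A -> (forall n, 0 <= b n) -> cvgn (series b) ->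
  (forall n, `|y n| <= A * `|x n| + b n) ->
  cvgn (norm_series e x) -> cvgn (norm_series e y).
Proof.
move=> A0 b0 cb xy cx.
(* only the norms of the coordinates matter, so everything happens in the
   sum of copies of [R] *)
pose r (u : nat -> R) : forall n, (fun=> R : completeNormedModType R) n := u.
have rE (Z : nat -> completeNormedModType R) (z : forall n, Z n) :
    norm_series e (r (fun n => `|z n|)) = norm_series (X := Z) e z.
  by congr series; apply/funext => n; rewrite /r normr_id.
rewrite -rE; apply: (@cvg_norm_series_le R E (fun=> R) e he
    (r (fun n => A * `|x n|)) (r b)).
- have := @cvg_norm_seriesZ R E (fun=> R) e (r (fun n => `|x n|)) A.
  by apply; rewrite rE.
- apply: normed_cvg; rewrite (_ : normed_series_of _ _ = series b)//.
  congr series; apply/funext => n /=.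
  by rewrite normrZ normr_id ne mulr1 ger0_norm.
- by move=> n; rewrite /r normr_id !ger0_norm// mulr_ge0.
Qed.

Lemma bsum_norm_dominated X Y (x : banach_sum X he) (y : banach_sum Y he) A b C :
  0 <= A -> (forall n, 0 <= b n) ->
  (forall n, `|bsum_seq y n| <= A * `|bsum_seq x n| + b n) ->
  (forall n, \sum_(0 <= i < n) b i <= C) ->
  `|y| <= A * `|x| + C.
Proof.
move=> A0 b0 xy bC; apply: bsum_norm_le => n.
rewrite (le_trans (norm_series_dominated A0 b0 xy bC n))// lerD2r ler_wpM2l//.
exact: norm_series_le_norm.
Qed.

Lemma norm_bsum_seq_le X (x : banach_sum X he) n : `|bsum_seq x n| <= `|x|.
Proof. by have := bsum_coord_le x n; rewrite ne mulr1. Qed.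

End domination.

(** * Maps between sums *)

Section bsum_map.
Context {R : realType} {E : completeNormedModType R} {e : nat -> E}.
Variables (he : one_unconditional_basic_sequence e) (ne : normalized e).
Variables (X Y : nat -> completeNormedModType R) (psi : forall n, X n -> Y n).
Arguments psi : clear implicits.
Variable L : R.
Hypotheses (L0 : 0 <= L) (psi0 : forall n, psi n 0 = 0).
Hypothesis psi_lip : forall n, coarse_lipschitz (psi n) L (weight n).

Local Notation SX := (banach_sum X he).
Local Notation SY := (banach_sum Y he).

Lemma bsum_map_proof (x : SX) :
  cvgn (norm_series e (fun n => psi n (bsum_seq x n))).
Proof.
apply: (cvg_norm_series_dominated he ne L0 weight_ge0 _ _ (svalP x)).
  rewrite (_ : weight = geometric 1 2^-1).
    apply: is_cvg_geometric_series.
    by rewrite ger0_norm ?invr_ge0// invf_lt1// ltr1n.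
  by apply/funext => n /=; rewrite mul1r.
by move=> n; have := @psi_lip n (sval x n) 0; rewrite psi0 !subr0.
Qed.

Definition bsum_map (x : SX) : SY :=
  exist _ (fun n => psi n (bsum_seq x n)) (@bsum_map_proof x).

Lemma coarse_lipschitz_bsum_map : coarse_lipschitz bsum_map L 2.
Proof.
move=> x y; apply: (bsum_norm_dominated ne L0 weight_ge0) => n.
  exact: psi_lip.
by rewrite (le_trans (sum_weight_le _ _))// /weight expr0 mulr1.
Qed.

Lemma coarse_expansive_bsum_map K : 0 <= K ->
  (forall n, coarse_expansive (psi n) K (weight n)) ->
  coarse_expansive bsum_map K 2.
Proof.
move=> K0 psi_exp x y; apply: (bsum_norm_dominated ne K0 weight_ge0) => n.
  exact: psi_exp.
by rewrite (le_trans (sum_weight_le _ _))// /weight expr0 mulr1.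
Qed.

Lemma bsum_map_coarse_equivalence K : 0 < K ->
  (forall n, coarse_expansive (psi n) K (weight n)) ->
  cobounded bsum_map -> coarse_equivalence bsum_map.
Proof.
move=> K0 psi_exp bPsi; split => //.
- by apply: (coarse_lipschitz_coarse L0); exact: coarse_lipschitz_bsum_map.
- apply: (coarse_expansive_expanding K0).
  exact: coarse_expansive_bsum_map (ltW K0) psi_exp.
Qed.

(** The preimages are chosen coordinatewise; they form an element of the sum
    because the coordinate maps are expansive. *)
Lemma bsum_map_net K : 0 <= K ->
  (forall n, coarse_expansive (psi n) K (weight n)) ->
  (forall n y, exists x, `|y - psi n x| <= weight n) ->
  forall y : SY, exists x, `|y - bsum_map x| <= 2.
Proof.
move=> K0 psi_exp psi_net y.
have [x xy] : exists x : forall n, X n,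
    forall n, `|bsum_seq y n - psi n (x n)| <= weight n.
  exists (fun n => projT1 (cid (psi_net n (bsum_seq y n)))) => n.
  by case: cid.
have cx : cvgn (norm_series e x).
  apply: (cvg_norm_series_dominated he ne K0 (b := fun n => (K + 1) * weight n)
      _ _ _ (svalP y)).
  - by move=> n; rewrite mulr_ge0 ?weight_ge0// addr_ge0.
  - rewrite (_ : (fun _ => _) = geometric (K + 1) 2^-1)//.
    apply: is_cvg_geometric_series.
    by rewrite ger0_norm ?invr_ge0// invf_lt1// ltr1n.
  - move=> n; have := psi_exp n (x n) 0; rewrite psi0 !subr0 => /le_trans; apply.
    have : `|psi n (x n)| <= `|sval y n| + weight n.
      rewrite -[psi n (x n)](subrK (sval y n)) addrC (le_trans (ler_normD _ _))//.
      by rewrite lerD2l distrC; exact: xy.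
    by move/(ler_wpM2l K0) => h; rewrite mulrDl mul1r addrA lerD2r -mulrDr.
exists (exist _ x cx); rewrite -[leRHS]add0r -[X in _ <= X + _](mul0r `|y|).
apply: (bsum_norm_dominated ne (lexx 0) weight_ge0) => n.
  by rewrite mul0r add0r; exact: xy.
by rewrite (le_trans (sum_weight_le _ _))// /weight expr0 mulr1.
Qed.

(** Finitely many coordinates are controlled by the continuity of the
    coordinate maps, and all the others at once by the weights. The filter [F]
    of pairs of points is what makes uniform continuity and continuity at a
    point two instances of the same fact. *)
Lemma bsum_map_near (F : set_system (SX * SX)) : Filter F ->
  (forall eps : R, 0 < eps -> \forall z \near F, `|z.1 - z.2| <= eps) ->
  (forall n (eps : R), 0 < eps ->
    \forall z \near F, `|psi n (bsum_seq z.1 n) - psi n (bsum_seq z.2 n)| <= eps) ->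
  forall eps : R, 0 < eps ->
    \forall z \near F, `|bsum_map z.1 - bsum_map z.2| <= eps.
Proof.
move=> FF F0 Fpsi eps eps0.
have L10 : 0 < L + 1 by rewrite ltr_wpDl.
have [N wN] := weight_small (divr_gt0 eps0 (ltr0n R 8)).
pose eta := eps / 8; have eta0 : 0 < eta by rewrite divr_gt0.
have Fn : \forall z \near F, forall i : 'I_N,
    `|psi i (bsum_seq z.1 i) - psi i (bsum_seq z.2 i)| <= eta * weight i.
  by apply: filter_forall => i; apply: Fpsi; rewrite mulr_gt0// weight_gt0.
have dF := F0 _ (divr_gt0 eps0 (mulr_gt0 (ltr0n R 2) L10)).
apply: filterS2 dF Fn => -[x y] /= xy xyN.
(* the coordinates below [N] have defect [eta * weight i], the others at most
   [(1 + eta) * weight i]; the sum is at most [2 * eta + 2 * weight N] *)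
pose b i := eta * weight i + (if (N <= i)%N then weight i else 0).
have b0 i : 0 <= b i.
  rewrite addr_ge0//; first by rewrite mulr_ge0 ?weight_ge0// ltW.
  by case: ifP => // _; exact: weight_ge0.
have bC n : \sum_(0 <= i < n) b i <= eps / 2.
  rewrite big_split/= -mulr_sumr.
  have h1 := @sum_weight_le R 0 n; have h2 := @sum_weight_tail_le R N n.
  rewrite (@le_trans _ _ (eta * (2 * weight 0) + 2 * weight N))//.
    by apply: lerD => //; apply: ler_wpM2l => //; exact: ltW.
  by rewrite /weight expr0 -/(weight N) /eta; lra.
have := @bsum_norm_dominated _ _ _ he ne _ _ (x - y) (bsum_map x - bsum_map y)
  L b (eps / 2) L0 b0 _ bC.
move=> h; apply: le_trans (h _) _.
  move=> i; have [Ni|iN] := leqP N i; rewrite /b.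
    rewrite Ni (le_trans (psi_lip _ _))// lerD2l lerDr.
    by rewrite mulr_ge0 ?weight_ge0// ltW.
  rewrite leqNgt iN addr0 (le_trans (xyN (Ordinal iN)))//= lerDr.
  by rewrite mulr_ge0.
rewrite [leRHS]splitr lerD2r.
apply: (@le_trans _ _ ((L + 1) * `|x - y|)); first by rewrite ler_wpM2r// lerDl.
by move: xy; rewrite invfM mulrA ler_pdivlMr// mulrC.
Qed.

Lemma continuous_bsum_map : (forall n, continuous (psi n)) -> continuous bsum_map.
Proof.
move=> cpsi x; apply/(@cvgrPdist_le _ _ _ _ (nbhs_filter x)) => eps eps0.
apply: (@bsum_map_near ((fun y => (x, y)) @ nbhs x)) eps eps0.
  move=> eps eps0; apply/nbhs_ballP; exists eps => // y.
  by rewrite -ball_normE/= => /ltW.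
move=> n eps eps0.
have /cvgrPdist_le/(_ _ eps0) := @cpsi n (bsum_seq x n).
move=> /nbhs_ballP[d d0 dpsi].
apply/nbhs_ballP; exists d => // y; rewrite -ball_normE/= => xyd.
apply: dpsi; rewrite -ball_normE/=; apply: le_lt_trans xyd.
exact: (norm_bsum_seq_le ne (x - y)).
Qed.

Lemma unif_continuous_bsum_map :
  (forall n, unif_continuous (psi n)) -> unif_continuous bsum_map.
Proof.
move=> upsi; apply/unif_continuous_normP; apply: bsum_map_near.
  by move=> eps eps0; apply/near_entourage_norm; exists eps.
move=> n eps eps0.
have /unif_continuous_normP/(_ _ eps0)/near_entourage_norm[d d0 dpsi] := upsi n.
apply/near_entourage_norm; exists d => // x y xyd; apply: dpsi.
by apply: le_trans xyd; exact: (norm_bsum_seq_le ne (x - y)).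
Qed.

End bsum_map.

(** * Choosing the scales *)

Section scales.
Context {R : realType} {X Y : nat -> completeNormedModType R}.
Variable phi : forall n, X n -> Y n.
Arguments phi : clear implicits.

Lemma omega_slope_bound :
  (ereal_sup [set lim ((omega (phi n) t * (t^-1)%:E)%E @[t --> +oo%R])
             | n in [set: nat]] < +oo)%E ->
  exists2 L : R, 0 <= L &
    forall n, (lim ((omega (phi n) t * (t^-1)%:E)%E @[t --> +oo%R]) < L%:E)%E.
Proof.
set A := [set _ | _ in _] => supA.
have supL (L : R) : (ereal_sup A < L%:E)%E ->
    forall n, (lim ((omega (phi n) t * (t^-1)%:E)%E @[t --> +oo%R]) < L%:E)%E.
  by move=> AL n; apply: le_lt_trans AL; apply: ereal_sup_ubound; exists n.
case: (ereal_sup A) supA supL => [r _|//|_] supL.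
  exists (Num.max 0 (r + 1)); first by rewrite le_max lexx.
  by apply: supL; rewrite lte_fin lt_max ltrDl ltr01 orbT.
by exists 0 => //; apply: supL; rewrite ltNyr.
Qed.

Lemma rho_slope_bound :
  (0 < ereal_inf [set lim ((rho (phi n) t * (t^-1)%:E)%E @[t --> +oo%R])
                 | n in [set: nat]])%E ->
  exists2 c : R, 0 < c &
    forall n, (c%:E < lim ((rho (phi n) t * (t^-1)%:E)%E @[t --> +oo%R]))%E.
Proof.
set A := [set _ | _ in _] => infA.
have infc (c : R) : (c%:E < ereal_inf A)%E ->
    forall n, (c%:E < lim ((rho (phi n) t * (t^-1)%:E)%E @[t --> +oo%R]))%E.
  by move=> cA n; apply: lt_le_trans cA _; apply: ereal_inf_lbound; exists n.
case: (ereal_inf A) infA infc => [r|_|//] => [|infc].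
  rewrite lte_fin => r0 infc; exists (r / 2); first by rewrite divr_gt0.
  by apply: infc; rewrite lte_fin ltr_pdivrMr// ltr_pMr// ltr1n.
by exists 1 => //; apply: infc; rewrite ltry.
Qed.

(** The defects [D n] of the maps may be unbounded, but at the scale
    [D n / weight n] they become [weight n]. The extra constants [C n] let
    further quantities, such as the density of the image, be made small too. *)
Lemma exists_scales (L c : R) (C : nat -> R) : 0 < c ->
  (forall n, (lim ((omega (phi n) t * (t^-1)%:E)%E @[t --> +oo%R]) < L%:E)%E) ->
  (forall n, (c%:E < lim ((rho (phi n) t * (t^-1)%:E)%E @[t --> +oo%R]))%E) ->
  (forall n, coarse (phi n)) ->
  exists2 s : nat -> R, forall n, 0 < s n & forall n,
    [/\ coarse_lipschitz (rescale (s n) (phi n)) L (weight n),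
        coarse_expansive (rescale (s n) (phi n)) c^-1 (weight n) &
        C n / s n <= weight n].
Proof.
move=> c0 phiL cphi phic.
have /choice[D1 phiD1] n := coarse_lipschitz_omega (phic n) (phiL n).
have /choice[D2 phiD2] n := coarse_expansive_rho c0 (cphi n).
pose D n := Num.max 1 (Num.max (C n) (Num.max (D1 n) (D2 n))).
have D0 n : 0 < D n by rewrite lt_max ltr01.
have CD n : C n <= D n by rewrite !le_max lexx orbT.
have D1D n : D1 n <= D n by rewrite !le_max lexx !orbT.
have D2D n : D2 n <= D n by rewrite !le_max lexx !orbT.
have s0 n : 0 < D n / weight n by rewrite divr_gt0// weight_gt0.
have le_w n d : d <= D n -> d / (D n / weight n) <= weight n.
  by move=> dD; rewrite ler_pdivrMr// mulrC divfK ?gt_eqF// weight_gt0.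
exists (fun n => D n / weight n) => // n; split; last exact: le_w.
- move=> x y; rewrite (le_trans (coarse_lipschitz_rescale (s0 n) (phiD1 n) x y))//.
  by rewrite lerD2l le_w.
- move=> x y; rewrite (le_trans (coarse_expansive_rescale (s0 n) (phiD2 n) x y))//.
  by rewrite lerD2l le_w.
Qed.

End scales.

(** * Inverses of maps between sums *)

Section bsum_map_inverse.
Context {R : realType} {E : completeNormedModType R} {e : nat -> E}.
Variables (he : one_unconditional_basic_sequence e) (ne : normalized e).
Variables (X Y : nat -> completeNormedModType R).
Variables (psi : forall n, X n -> Y n) (psi' : forall n, Y n -> X n).
Arguments psi : clear implicits.
Arguments psi' : clear implicits.
Variables L K : R.
Hypotheses (L0 : 0 <= L) (K0 : 0 <= K) (psi0 : forall n, psi n 0 = 0).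
Hypothesis psi_lip : forall n, coarse_lipschitz (psi n) L (weight n).
Hypothesis psi_exp : forall n, coarse_expansive (psi n) K (weight n).
Hypotheses (psiK : forall n, cancel (psi n) (psi' n))
           (psi'K : forall n, cancel (psi' n) (psi n)).

Local Notation Psi := (bsum_map (he := he) ne L0 psi0 psi_lip).

(** A coarse expansiveness estimate for a bijection is a coarse Lipschitz
    estimate for its inverse. *)
Lemma coarse_lipschitz_inverse n : coarse_lipschitz (psi' n) K (weight n).
Proof. by move=> u v; have := @psi_exp n (psi' n u) (psi' n v); rewrite !psi'K. Qed.

Lemma inverse0 n : psi' n 0 = 0.
Proof. by rewrite -(psi0 n) psiK. Qed.

Local Notation Psi' := (bsum_map (he := he) ne K0 inverse0 coarse_lipschitz_inverse).

Lemma bsum_mapK : cancel Psi Psi'.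
Proof. by move=> x; apply: bsum_seq_inj => n; exact: psiK. Qed.

Lemma bsum_map_inverseK : cancel Psi' Psi.
Proof. by move=> y; apply: bsum_seq_inj => n; exact: psi'K. Qed.

Lemma bsum_map_uniform_homeomorphism :
  (forall n, unif_continuous (psi n)) -> (forall n, unif_continuous (psi' n)) ->
  uniform_homeomorphism Psi.
Proof.
move=> upsi upsi'; exists Psi'; split.
- exact: bsum_mapK.
- exact: bsum_map_inverseK.
- exact: unif_continuous_bsum_map.
- exact: unif_continuous_bsum_map.
Qed.

Lemma bsum_map_homeomorphism :
  (forall n, continuous (psi n)) -> (forall n, continuous (psi' n)) ->
  homeomorphism Psi.
Proof.
move=> cpsi cpsi'; exists Psi'; split.
- exact: bsum_mapK.
- exact: bsum_map_inverseK.
- exact: continuous_bsum_map.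
- exact: continuous_bsum_map.
Qed.

End bsum_map_inverse.

Theorem theorem7p1 (R : realType) (X Y : nat -> completeNormedModType R)
  (phi : forall n, X n -> Y n)
  (E : completeNormedModType R) (e : nat -> E)
  (he : one_unconditional_basic_sequence e) (ne : normalized e)
  (hsup : (ereal_sup [set lim (omega (phi n) t * (t^-1)%:E @[t --> +oo%R])
                     | n in [set: nat]] < +oo)%E)
  (hinf : (0 < ereal_inf [set lim (rho (phi n) t * (t^-1)%:E @[t --> +oo%R])
                         | n in [set: nat]])%E) :
  [/\ (forall n, coarse_equivalence (phi n)) ->
        coarsely_equivalent (banach_sum X he) (banach_sum Y he),
      (forall n, uniform_homeomorphism (phi n)) ->
        uniformly_homeomorphic (banach_sum X he) (banach_sum Y he) &
      (forall n, homeomorphism (phi n) /\ coarse_equivalence (phi n)) ->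
        homeomorphically_and_coarsely_equivalent
          (banach_sum X he) (banach_sum Y he)].
Proof.
have [L L0 phiL] := omega_slope_bound hsup.
have [c c0 cphi] := rho_slope_bound hinf.
have K0 : 0 < c^-1 by rewrite invr_gt0.
split=> phiP.
- have cphi' n : coarse (phi n) by have [] := phiP n.
  have /choice[C phiC] n : exists C, forall y, exists x, `|y - phi n x| <= C.
    by have [_ _ /cobounded_exists] := phiP n.
  have [s s0 /all_and3[psi_lip psi_exp sC]] :=
    exists_scales C c0 phiL cphi cphi'.
  have psi0 n : rescale (s n) (phi n) 0 = 0 by exact: rescale0.
  exists (bsum_map (he := he) ne L0 psi0 psi_lip).
  apply: (bsum_map_coarse_equivalence K0 psi_exp).
  apply: (@cobounded_net _ _ _ _ 2).
  apply: bsum_map_net (ltW K0) psi_exp _ => n y.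
  have [x xC] := rescale_net (s0 n) (phiC n) y.
  by exists x; exact: le_trans (sC n).
- have cphi' n : coarse (phi n).
    by have [g [_ _ /unif_continuous_coarse]] := phiP n.
  have [s s0 /all_and3[psi_lip psi_exp _]] :=
    exists_scales (fun=> 0) c0 phiL cphi cphi'.
  have psi0 n : rescale (s n) (phi n) 0 = 0 by exact: rescale0.
  pose g n := projT1 (cid (phiP n)).
  have gP n : [/\ cancel (phi n) (g n), cancel (g n) (phi n),
      unif_continuous (phi n) & unif_continuous (g n)] by rewrite /g; case: cid.
  exists (bsum_map (he := he) ne L0 psi0 psi_lip).
  apply: (@bsum_map_uniform_homeomorphism _ _ _ _ _ _ _ _
    (fun n => rescale_inv (s n) (phi n) (g n)) _ c^-1 L0 (ltW K0)) => // n;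
    have [phiK gK uphi ug] := gP n.
  + exact: rescaleK.
  + exact: rescale_invK.
  + exact: unif_continuous_rescale.
  + exact: unif_continuous_rescale_inv.
- have cphi' n : coarse (phi n) by have [_ []] := phiP n.
  have [s s0 /all_and3[psi_lip psi_exp _]] :=
    exists_scales (fun=> 0) c0 phiL cphi cphi'.
  have psi0 n : rescale (s n) (phi n) 0 = 0 by exact: rescale0.
  pose g n := projT1 (cid (phiP n).1).
  have gP n : [/\ cancel (phi n) (g n), cancel (g n) (phi n),
      continuous (phi n) & continuous (g n)] by rewrite /g; case: cid.
  have homeo : homeomorphism (bsum_map (he := he) ne L0 psi0 psi_lip).
    apply: (@bsum_map_homeomorphism _ _ _ _ _ _ _ _
      (fun n => rescale_inv (s n) (phi n) (g n)) _ c^-1 L0 (ltW K0)) => // n;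
      have [phiK gK cphin cg] := gP n.
    + exact: rescaleK.
    + exact: rescale_invK.
    + exact: continuous_rescale.
    + exact: continuous_rescale_inv.
  exists (bsum_map (he := he) ne L0 psi0 psi_lip); split => //.
  apply: (bsum_map_coarse_equivalence K0 psi_exp).
  have [Psi' [_ Psi'K _ _]] := homeo.
  apply: (@cobounded_net _ _ _ _ 0) => y; exists (Psi' y).
  by rewrite Psi'K subrr normr0.
Qed.
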